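(* Let $(X,\mathcal{F},\mu)$ be a complete measure space and let $\mathcal{H}$ be a Hilbert space. Let $\mathrm{id}\overline{\otimes}q:\mathbb{B}(\mathcal{H})\overline{\otimes}M^\infty(\mathcal{F})\to\mathbb{B}(\mathcal{H})\overline{\otimes}L^\infty(X,\mu)$ be the unique unital completely positive map extending $\mathrm{id}\odot q$. If there is a lifting $\rho$ for $(X,\mathcal{F},\mu)$, then the unique unital completely positive map $\mathrm{id}\overline{\otimes}\rho:\mathbb{B}(\mathcal{H})\overline{\otimes}L^\infty(X,\mu)\to\mathbb{B}(\mathcal{H})\overline{\otimes}M^\infty(\mathcal{F})$ extending $\mathrm{id}\odot\rho$ is a unital complete order embedding, and it satisfies $(\mathrm{id}\overline{\otimes}q)\circ(\mathrm{id}\overline{\otimes}\rho)=\mathrm{id}$.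
   Context: $M^\infty(\mathcal{F})$ is the $\mathrm{C}^*$-algebra of bounded $\mathcal{F}$-measurable complex functions on $X$ (a $\mathrm{C}^*$-subalgebra of $\ell^\infty(X)$), and $q:M^\infty(\mathcal{F})\to L^\infty(X,\mu)$ is the surjective $*$-homomorphism identifying functions that agree $\mu$-a.e. A lifting for $(X,\mathcal{F},\mu)$ is a unital $*$-homomorphism $\rho:L^\infty(X,\mu)\to M^\infty(\mathcal{F})$ with $q\circ\rho=\mathrm{id}$. Fubini tensor product (Hamana): let $\mathcal{S}\subseteq\mathbb{B}(\mathcal{K})$ be a norm-closed operator system, let $\{e_\alpha:\alpha\in A\}$ be an orthonormal basis of $\mathcal{H}$, and let $J_\alpha:\mathcal{K}\to\mathcal{H}\otimes\mathcal{K}$, $J_\alpha(k)=e_\alpha\otimes k$. Then $\mathbb{B}(\mathcal{H})\overline{\otimes}\mathcal{S}$ is the operator system $$\mathbb{B}(\mathcal{H})\overline{\otimes}\mathcal{S}=\{x\in\mathbb{B}(\mathcal{H}\otimes\mathcal{K}): J_\alpha^*xJ_\beta\in\mathcal{S}\text{ for all }\alpha,\beta\in A\}.$$ Here $M^\infty(\mathcal{F})$ and $L^\infty(X,\mu)$ are regarded as norm-closed operator systems via faithful unital representations on Hilbert spaces. $\mathrm{id}\odot\phi$ denotes the algebraic tensor product map $\mathbb{B}(\mathcal{H})\odot\mathcal{S}\to\mathbb{B}(\mathcal{H})\odot\mathcal{T}$ induced by a linear map $\phi:\mathcal{S}\to\mathcal{T}$. By a lemma of Hamana, for every unital completely positive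 $\phi:\mathcal{S}\to\mathcal{T}$ between norm-closed operator systems, there is a unique unital completely positive map $\mathrm{id}\overline{\otimes}\phi:\mathbb{B}(\mathcal{H})\overline{\otimes}\mathcal{S}\to\mathbb{B}(\mathcal{H})\overline{\otimes}\mathcal{T}$ extending $\mathrm{id}\odot\phi$. A unital complete order embedding is a unital completely positive injective map whose inverse on its range is completely positive. *)

(* Defs.v *)
From HB Require Import structures.
From mathcomp Require Import all_boot all_order all_algebra.
From mathcomp Require Import sesquilinear complex.
From mathcomp Require Import all_classical all_reals all_analysis.
From mathcomp Require Import measurable_realfun.

Set Implicit Arguments.
Unset Strict Implicit.
Unset Printing Implicit Defensive.

Import Order.TTheory GRing.Theory Num.Theory.
Import numFieldNormedType.Exports.

Local Open Scope classical_set_scope.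
Local Open Scope ring_scope.
Local Open Scope complex_scope.

(* Unital *-algebras over the complex numbers; alg_scalar a is a 1. MathComp's
   lalgType and algType exclude the zero ring, hence L^oo(mu) for mu = 0. *)
HB.mixin Record isStarAlgebra (R : rcfType) A of GRing.PzRing A := {
  alg_scalar : {rmorphism R[i] -> A};
  star : A -> A;
  alg_scalarC : forall (a : R[i]) (x : A), alg_scalar a * x = x * alg_scalar a;
  starD : {morph star : x y / x + y};
  starM : forall x y : A, star (x * y) = star y * star x;
  star_scalar : forall a : R[i],
    star (alg_scalar a) = alg_scalar (Num.conj a);
  starK : involutive star
}.

#[short(type="starAlgType")]
HB.structure Definition StarAlgebra (R : rcfType) :=
  {A of GRing.PzRing A & isStarAlgebra R A}.

Definition star_morphism (R : rcfType) (A B : starAlgType R) (f : A -> B) :=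
  [/\ forall (a : R[i]) x y,
        f (alg_scalar a * x + y) = alg_scalar a * f x + f y,
      monoid_morphism f &
      {morph f : x / star x}].

Section BoundedMeasurable.
Context (d : measure_display) (X : measurableType d) (R : realType).

Definition bounded_measurable (f : X -> R[i]) : Prop :=
  [/\ measurable_fun setT (fun x => complex.Re (f x)),
      measurable_fun setT (fun x => complex.Im (f x)) &
      exists M : R[i], forall x, `|f x| <= M].

Definition bmfun_pred : {pred X -> R[i]} :=
  [pred f | `[< bounded_measurable f >]].

(* Elements of M^oo(F), F being the sigma-algebra of X. *)
Record bmfun := BMFun {
  bmfun_fun :> X -> R[i];
  bmfun_subproof : bmfun_fun \in bmfun_pred }.

HB.instance Definition _ := [isSub for bmfun_fun].
HB.instance Definition _ := [Choice of bmfun by <:].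

Lemma bmfunP (f g : bmfun) : (forall x, f x = g x) -> f = g.
Proof. by move=> fg; apply: val_inj; apply: funext. Qed.

Lemma bmfun_bounded_measurable (f : bmfun) : bounded_measurable f.
Proof. by apply/asboolP; exact: bmfun_subproof. Qed.

Lemma bounded_measurable_cst (a : R[i]) : bounded_measurable (cst a).
Proof.
by split; [exact: measurable_cst|exact: measurable_cst|exists `|a|].
Qed.

Lemma bounded_measurableB f g : bounded_measurable f -> bounded_measurable g ->
  bounded_measurable (f - g).
Proof.
move=> [fR fI [M fM]] [gR gI [N gN]]; split.
- rewrite (_ : (fun x => _) =
    (fun x => complex.Re (f x)) \- (fun x => complex.Re (g x))).
    exact: measurable_funB.
  by apply/funext => x /=; rewrite !fctE; case: (f x) (g x) => [? ?] [? ?].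
- rewrite (_ : (fun x => _) =
    (fun x => complex.Im (f x)) \- (fun x => complex.Im (g x))).
    exact: measurable_funB.
  by apply/funext => x /=; rewrite !fctE; case: (f x) (g x) => [? ?] [? ?].
- exists (M + N) => x; rewrite !fctE.
  by rewrite (le_trans (ler_normB _ _))// lerD.
Qed.

Lemma bounded_measurableM f g : bounded_measurable f -> bounded_measurable g ->
  bounded_measurable (f * g).
Proof.
move=> [fR fI [M fM]] [gR gI [N gN]]; split.
- rewrite (_ : (fun x => _) =
    ((fun x => complex.Re (f x)) \* (fun x => complex.Re (g x))) \-
    ((fun x => complex.Im (f x)) \* (fun x => complex.Im (g x)))).
    by apply: measurable_funB; exact: measurable_funM.
  by apply/funext => x /=; rewrite !fctE; case: (f x) (g x) => [? ?] [? ?].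
- rewrite (_ : (fun x => _) =
    ((fun x => complex.Re (f x)) \* (fun x => complex.Im (g x))) \+
    ((fun x => complex.Im (f x)) \* (fun x => complex.Re (g x)))).
    by apply: measurable_funD; exact: measurable_funM.
  by apply/funext => x /=; rewrite !fctE; case: (f x) (g x) => [? ?] [? ?].
- exists (M * N) => x; rewrite !fctE.
  by rewrite normrM ler_pM.
Qed.

Lemma bounded_measurable_conj (f : X -> R[i]) : bounded_measurable f ->
  bounded_measurable (fun x => Num.conj (f x)).
Proof.
move=> [fR fI [M fM]]; split.
- rewrite (_ : (fun x => _) = (fun x => complex.Re (f x)))//.
  by apply/funext => x; case: (f x).
- rewrite (_ : (fun x => _) = \- (fun x => complex.Im (f x))).
    exact: measurable_funN.
  by apply/funext => x /=; case: (f x).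
- by exists M => x; rewrite norm_conjC.
Qed.

Lemma bmfun_subring_closed : subring_closed bmfun_pred.
Proof.
split; first exact/asboolP/bounded_measurable_cst.
- by move=> f g /asboolP fm /asboolP gm; exact/asboolP/bounded_measurableB.
- by move=> f g /asboolP fm /asboolP gm; exact/asboolP/bounded_measurableM.
Qed.

HB.instance Definition _ := GRing.SubChoice_isSubComPzRing.Build
  (X -> R[i]) bmfun_pred bmfun bmfun_subring_closed.

Definition bmfun_cst (a : R[i]) : bmfun :=
  BMFun (asboolT (bounded_measurable_cst a)).

Definition bmfun_conj (f : bmfun) : bmfun :=
  BMFun (asboolT (bounded_measurable_conj (bmfun_bounded_measurable f))).

Fact bmfun_cst_zmod_morphism : zmod_morphism bmfun_cst.
Proof. by move=> a b; exact: bmfunP. Qed.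
Fact bmfun_cst_monoid_morphism : monoid_morphism bmfun_cst.
Proof. by split=> [|a b]; exact: bmfunP. Qed.
HB.instance Definition _ := GRing.isZmodMorphism.Build R[i] bmfun
  bmfun_cst bmfun_cst_zmod_morphism.
HB.instance Definition _ := GRing.isMonoidMorphism.Build R[i] bmfun
  bmfun_cst bmfun_cst_monoid_morphism.

Fact bmfun_cstC (a : R[i]) (f : bmfun) : bmfun_cst a * f = f * bmfun_cst a.
Proof. exact: mulrC. Qed.
Fact bmfun_conjD : {morph bmfun_conj : f g / f + g}.
Proof. by move=> f g; apply: bmfunP => x; exact: (rmorphD Num.conj). Qed.
Fact bmfun_conjM (f g : bmfun) :
  bmfun_conj (f * g) = bmfun_conj g * bmfun_conj f.
Proof.
by rewrite [RHS]mulrC; apply: bmfunP => x; exact: (rmorphM Num.conj).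
Qed.
Fact bmfun_conj_cst (a : R[i]) :
  bmfun_conj (bmfun_cst a) = bmfun_cst (Num.conj a).
Proof. exact: bmfunP. Qed.
Fact bmfun_conjK : involutive bmfun_conj.
Proof. by move=> f; apply: bmfunP => x; exact: conjCK. Qed.

HB.instance Definition _ := @isStarAlgebra.Build R bmfun bmfun_cst bmfun_conj
  bmfun_cstC bmfun_conjD bmfun_conjM bmfun_conj_cst bmfun_conjK.

End BoundedMeasurable.

Section Linfty.
Context (d : measure_display) (X : measurableType d) (R : realType).
Variable mu : {measure set X -> \bar R}.
Local Notation M := (bmfun X R).
Local Open Scope quotient_scope.

Definition bm_ae_eq (f g : M) := `[< f = g %[ae mu] >].

Let bm_ae_eq_refl : reflexive bm_ae_eq.
Proof. by move=> f; apply/asboolP; exact: aeW. Qed.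
Let bm_ae_eq_sym : symmetric bm_ae_eq.
Proof.
by move=> f g; apply/idP/idP => /asboolP h; apply/asboolP;
   apply: filterS h => x h ?; rewrite h.
Qed.
Let bm_ae_eq_trans : transitive bm_ae_eq.
Proof.
move=> f g h /asboolP gf /asboolP fh; apply/asboolP.
by apply: filterS2 gf fh => x + + ? => -> // ->.
Qed.

Canonical bm_ae_eq_canonical :=
  EquivRel bm_ae_eq bm_ae_eq_refl bm_ae_eq_sym bm_ae_eq_trans.

(* L^oo(X, mu): every essentially bounded measurable function agrees a.e. with
   a bounded measurable one, so classes of the latter suffice. *)
Definition Linf : Type := {eq_quot bm_ae_eq}.
HB.instance Definition _ := Choice.on Linf.
HB.instance Definition _ := EqQuotient.on Linf.

Definition Linf_class (f : M) : Linf := \pi_Linf f.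
Local Notation q := Linf_class.

Lemma Linf_classP (f g : M) :
  q f = q g <-> (f = g %[ae mu]).
Proof.
split=> [/eqmodP /asboolP //|fg]; apply/eqmodP; exact/asboolP.
Qed.

Lemma repr_Linf_class f : (repr (q f) = f %[ae mu]).
Proof. by apply/Linf_classP; exact: reprK. Qed.

Lemma Linf_class_repr (u : Linf) : q (repr u) = u.
Proof. exact: reprK. Qed.

Definition Linf_add (u v : Linf) := q (repr u + repr v).
Definition Linf_opp (u : Linf) := q (- repr u).
Definition Linf_mul (u v : Linf) := q (repr u * repr v).
Definition Linf_star (u : Linf) := q (star (repr u)).

Lemma Linf_class_add f g : Linf_add (q f) (q g) = q (f + g).
Proof.
apply/Linf_classP; have := repr_Linf_class f; have := repr_Linf_class g.
by apply: filterS2 => x /(_ I) hg /(_ I) hf _; congr (_ + _).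
Qed.
Lemma Linf_class_opp f : Linf_opp (q f) = q (- f).
Proof.
apply/Linf_classP; have := repr_Linf_class f.
by apply: filterS => x /(_ I) hf _; congr (- _).
Qed.
Lemma Linf_class_mul f g : Linf_mul (q f) (q g) = q (f * g).
Proof.
apply/Linf_classP; have := repr_Linf_class f; have := repr_Linf_class g.
by apply: filterS2 => x /(_ I) hg /(_ I) hf _; congr (_ * _).
Qed.
Lemma Linf_class_star f : Linf_star (q f) = q (star f).
Proof.
apply/Linf_classP; have := repr_Linf_class f.
by apply: filterS => x /(_ I) hf _; congr (Num.conj _).
Qed.

Let qE := (Linf_class_add, Linf_class_opp, Linf_class_mul, Linf_class_star).

Fact Linf_addA : associative Linf_add.
Proof.
move=> u v w; rewrite -(Linf_class_repr u) -(Linf_class_repr v).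
by rewrite -(Linf_class_repr w) !qE addrA.
Qed.
Fact Linf_addC : commutative Linf_add.
Proof.
by move=> u v; rewrite -(Linf_class_repr u) -(Linf_class_repr v) !qE addrC.
Qed.
Fact Linf_add0 : left_id (q 0) Linf_add.
Proof. by move=> u; rewrite -(Linf_class_repr u) !qE add0r. Qed.
Fact Linf_addN : left_inverse (q 0) Linf_opp Linf_add.
Proof. by move=> u; rewrite -(Linf_class_repr u) !qE addNr. Qed.

HB.instance Definition _ :=
  GRing.isZmodule.Build Linf Linf_addA Linf_addC Linf_add0 Linf_addN.

Fact Linf_mulA : associative Linf_mul.
Proof.
move=> u v w; rewrite -(Linf_class_repr u) -(Linf_class_repr v).
by rewrite -(Linf_class_repr w) !qE mulrA.
Qed.
Fact Linf_mulC : commutative Linf_mul.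
Proof.
by move=> u v; rewrite -(Linf_class_repr u) -(Linf_class_repr v) !qE mulrC.
Qed.
Fact Linf_mul1 : left_id (q 1) Linf_mul.
Proof. by move=> u; rewrite -(Linf_class_repr u) !qE mul1r. Qed.
Fact Linf_mulDl : left_distributive Linf_mul +%R.
Proof.
move=> u v w; rewrite -(Linf_class_repr u) -(Linf_class_repr v).
by rewrite -(Linf_class_repr w) /GRing.add /= !qE mulrDl.
Qed.

HB.instance Definition _ := GRing.Zmodule_isComPzRing.Build Linf
  Linf_mulA Linf_mulC Linf_mul1 Linf_mulDl.

Lemma Linf_classD f g : q (f + g) = q f + q g.
Proof. by rewrite -Linf_class_add. Qed.
Lemma Linf_classM f g : q (f * g) = q f * q g.
Proof. by rewrite -Linf_class_mul. Qed.

Definition Linf_cst (a : R[i]) : Linf := q (alg_scalar a).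

Fact Linf_cst_zmod_morphism : zmod_morphism Linf_cst.
Proof.
move=> a b; rewrite /Linf_cst rmorphB Linf_classD; congr (_ + _).
by rewrite -Linf_class_opp.
Qed.
Fact Linf_cst_monoid_morphism : monoid_morphism Linf_cst.
Proof.
by split=> [|a b]; rewrite /Linf_cst ?rmorph1// rmorphM Linf_classM.
Qed.
HB.instance Definition _ := GRing.isZmodMorphism.Build R[i] Linf
  Linf_cst Linf_cst_zmod_morphism.
HB.instance Definition _ := GRing.isMonoidMorphism.Build R[i] Linf
  Linf_cst Linf_cst_monoid_morphism.

Fact Linf_cstC (a : R[i]) (u : Linf) : Linf_cst a * u = u * Linf_cst a.
Proof. exact: mulrC. Qed.
Fact Linf_starD : {morph Linf_star : u v / u + v}.
Proof.
move=> u v; rewrite -(Linf_class_repr u) -(Linf_class_repr v) -Linf_classD.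
by rewrite !qE starD Linf_classD.
Qed.
Fact Linf_starM (u v : Linf) : Linf_star (u * v) = Linf_star v * Linf_star u.
Proof.
rewrite -(Linf_class_repr u) -(Linf_class_repr v) -Linf_classM !qE.
by rewrite starM Linf_classM.
Qed.
Fact Linf_star_cst (a : R[i]) : Linf_star (Linf_cst a) = Linf_cst (Num.conj a).
Proof. by rewrite /Linf_cst !qE star_scalar. Qed.
Fact Linf_starK : involutive Linf_star.
Proof. by move=> u; rewrite -(Linf_class_repr u) !qE starK. Qed.

HB.instance Definition _ := @isStarAlgebra.Build R Linf Linf_cst Linf_star
  Linf_cstC Linf_starD Linf_starM Linf_star_cst Linf_starK.

Lemma Linf_class_star_morphism : star_morphism Linf_class.
Proof.
split; first by move=> a f g; rewrite Linf_classD Linf_classM.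
  by split=> // f g; exact: Linf_classM.
by move=> f; rewrite -Linf_class_star.
Qed.

Lemma Linf_class_surj (u : Linf) : exists f, Linf_class f = u.
Proof. by exists (repr u); exact: Linf_class_repr. Qed.

Definition lifting (rho : Linf -> M) :=
  star_morphism rho /\ cancel rho Linf_class.

End Linfty.

(* The inner product is linear in the first argument. *)
HB.mixin Record hasInner (R : realType) V of CompleteNormedModule R[i] V := {
  inner : {dot V for @Num.conj R[i]};
  inner_norm : forall x : V, inner x x = `|x| ^+ 2
}.

#[short(type="hilbertType")]
HB.structure Definition Hilbert (R : realType) :=
  {V of CompleteNormedModule R[i] V & hasInner R V}.

Section Operators.
Context (R : realType).
Implicit Types H K HK : hilbertType R.

Definition bounded_op H K (T : H -> K) :=
  linear T /\ exists M : R[i], forall x, `|T x| <= M * `|x|.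

Definition is_adjoint H K (T : H -> K) (T' : K -> H) :=
  bounded_op T' /\ forall x y, inner (T x) y = inner x (T' y).

Definition lin_span H (S : set H) : set H :=
  [set x | exists n (c : 'I_n -> R[i]) (v : 'I_n -> H),
    (forall i, S (v i)) /\ x = \sum_(i < n) c i *: v i].

Definition orthonormal_basis H (A : Type) (e : A -> H) :=
  [/\ forall a, inner (e a) (e a) = 1,
      forall a b, a <> b -> inner (e a) (e b) = 0 &
      dense (lin_span (range e))].

(* HK, together with the elementary tensors h (x) k := t h k, is a Hilbert
   space tensor product of H and K; this determines it up to unitary. *)
Definition hilbert_tensor H K HK (t : H -> K -> HK) :=
  [/\ (forall k, linear (t ^~ k)) /\ (forall h, linear (t h)),
      forall h k h' k', inner (t h k) (t h' k') = inner h h' * inner k k' &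
      dense (lin_span [set t h k | h in setT & k in setT])].

Definition faithful_unital_rep (A : starAlgType R) K (pi : A -> K -> K) :=
  [/\ forall x, bounded_op (pi x),
      forall (a : R[i]) x y, pi (alg_scalar a * x + y) = a *: pi x + pi y,
      pi 1 = idfun /\ (forall x y, pi (x * y) = pi x \o pi y),
      forall x, is_adjoint (pi x) (pi (star x)) &
      injective pi].

(* J_a = t (e a) : K -> HK *)
Definition fubini H K HK (t : H -> K -> HK) (A : Type) (e : A -> H)
    (S : set (K -> K)) : set (HK -> HK) :=
  [set x | bounded_op x /\ forall a b, exists Ja,
    is_adjoint (t (e a)) Ja /\ S (Ja \o x \o t (e b))].

(* Positivity of [x i j] in M_n(B(K)) = B(K^n). *)
Definition mx_positive K (n : nat) (x : 'I_n -> 'I_n -> K -> K) :=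
  forall k : 'I_n -> K, 0 <= \sum_(i < n) inner (\sum_(j < n) x i j (k j)) (k i).

(* Maps between operator systems S and T are total functions on all
   (not necessarily bounded or linear) operators, of which only the values on S
   matter. *)
Definition completely_positive K K' (S : set (K -> K)) (T : set (K' -> K'))
    (Phi : (K -> K) -> (K' -> K')) :=
  [/\ set_fun S T Phi,
      forall (a : R[i]) x y, S x -> S y -> Phi (a *: x + y) = a *: Phi x + Phi y &
      forall n (x : 'I_n -> 'I_n -> K -> K), (forall i j, S (x i j)) ->
        mx_positive x -> mx_positive (fun i j => Phi (x i j))].

Definition ucp K K' (S : set (K -> K)) (T : set (K' -> K'))
    (Phi : (K -> K) -> (K' -> K')) :=
  completely_positive S T Phi /\ Phi idfun = idfun.

Definition unital_complete_order_embedding K K'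
    (S : set (K -> K)) (T : set (K' -> K')) (Phi : (K -> K) -> (K' -> K')) :=
  [/\ ucp S T Phi, set_inj S Phi &
      exists Psi, completely_positive (Phi @` S) S Psi /\
        (forall x, S x -> Psi (Phi x) = x)].

(* X is the element \sum_i T_i (x) s_i of B(H) (.) B(K), acting on HK. *)
Definition is_sum_tensor H K HK (t : H -> K -> HK) n
    (T : 'I_n -> H -> H) (s : 'I_n -> K -> K) (X : HK -> HK) :=
  bounded_op X /\ forall h k, X (t h k) = \sum_(i < n) t (T i h) (s i k).

(* Phi extends id (.) phi, where A and B are identified with their images
   under pi and pi'. *)
Definition extends_id_odot H K HK K' HK' (t : H -> K -> HK) (t' : H -> K' -> HK')
    (A B : starAlgType R) (pi : A -> K -> K) (pi' : B -> K' -> K')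
    (phi : A -> B) (Phi : (HK -> HK) -> (HK' -> HK')) :=
  forall n (T : 'I_n -> H -> H) (f : 'I_n -> A) X Y,
    (forall i, bounded_op (T i)) ->
    is_sum_tensor t T (fun i => pi (f i)) X ->
    is_sum_tensor t' T (fun i => pi' (phi (f i))) Y ->
    Phi X = Y.

End Operators.

(* Main.v *)
(* A unital completely positive map theta of B(H) (x) S into itself that fixes
   B(H) (.) S is the identity. Indeed, if p is a projection fixed by theta and
   q = 1 - p, applying theta to the positive matrix [[q, qx], [x^*q, |x|^2]] gives
   p theta(qx) = 0 and theta(x^*q) p = 0; exchanging p and q, theta(px) = p theta(x)
   and theta(xp) = theta(x) p. For the projections p_a onto C e_a (x) K this yields
   p_a theta(x) p_b = theta(p_a x p_b) = p_a x p_b, as p_a x p_b is an elementary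
   tensor, and the entries (a, b) determine an operator. This applies to
   theta = (id (x) q) o (id (x) rho) because q o rho = id; then id (x) q is a
   completely positive left inverse of id (x) rho. Adjoints of the operators x exist
   by the Riesz representation theorem, proved with a vector of minimal norm. *)
Require Import Defs.
From mathcomp Require Import all_boot all_order all_algebra.
From mathcomp Require Import sesquilinear complex.
From mathcomp Require Import all_classical all_reals all_analysis.
From mathcomp Require Import ring lra.

Set Implicit Arguments.
Unset Strict Implicit.
Unset Printing Implicit Defensive.

Import Order.TTheory GRing.Theory Num.Theory.
Import numFieldNormedType.Exports.

Local Open Scope classical_set_scope.
Local Open Scope ring_scope.

(** * Estimates for real and complex numbers *)

Lemma bounded_pos (R : realType) (T : Type) (n m : T -> R[i]) :
  (forall x, 0 <= n x) -> (forall x, 0 <= m x) ->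
  (exists M, forall x, m x <= M * n x) ->
  exists2 M, 0 < M & forall x, m x <= M * n x.
Proof.
(* If every [n x] is zero, nothing constrains [M], which may then be zero, negative or non-real;
   this choice is positive in all cases. *)
move=> n0 m0 [M hM]; exists (`|M| + 1).
  by rewrite ltr_wpDl.
move=> x; rewrite mulrDl mul1r ler_wpDr//.
apply: le_trans (hM x) _; rewrite -{2}(ger0_norm (n0 x)) -normrM ger0_norm//.
exact: le_trans (hM x).
Qed.

Lemma ltr0c (R : realType) (r : R) : (0 < real_complex R r) = (0 < r).
Proof. exact: (ltcR 0 r). Qed.

Lemma cplx_gt0 (R : realType) (e : R[i]) : 0 < e ->
  exists2 r : R, 0 < r & e = real_complex R r.
Proof. by case: e => r i; rewrite ltcE /= => /andP[/eqP-> r0]; exists r. Qed.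

(** Squaring [a - e < b] is allowed because [e <= a], and (a - e)^2 >= a^2 - 2ae = t - (t - s)/2. It
    serves to show that a limit of a minimising sequence has minimal norm. *)
Lemma sqr_gap (R : realType) (s t a e b c : R) : 0 <= s -> a ^+ 2 = t ->
  0 < a -> a * e = (t - s) / 4 -> a - e < b -> b ^+ 2 = c -> s + (t - s) / 2 <= c.
Proof.
move=> s0 <- a0 ae aeb <-.
have ea : e <= a by rewrite -(ler_pM2l a0) ae; nra.
by nra.
Qed.

Lemma invSn_lt (R : realType) (d : R) : 0 < d -> exists N, forall n, (N <= n)%N ->
  n.+1%:R^-1 < d.
Proof.
move=> d0; exists (Num.truncn d^-1) => n Nn.
rewrite -ltf_pV2 ?posrE ?invr_gt0// invrK (lt_le_trans (truncnS_gt _))//.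
by rewrite ler_nat ltnS.
Qed.

(** The case n = 0 gives [c >= 0], the case n = 1 then makes [z] real, and n |z| <= c for all n
    forces z = 0. *)
Lemma archi_bound_eq0 (R : realType) (z c : R[i]) :
  (forall n : nat, 0 <= c + n%:R * z) -> (forall n : nat, 0 <= c - n%:R * z) ->
  z = 0.
Proof.
move=> hp hm; have c0 : 0 <= c by have := hp 0%N; rewrite mul0r addr0.
have zR : z \is Num.real.
  have -> : z = (c + 1%:R * z) - c by rewrite mul1r addrC addKr.
  by rewrite rpredB// ger0_real.
move: c0 zR hp hm => /ger0_real/complex_realP[r ->] /complex_realP[w ->] hp hm.
congr (real_complex R _); apply/eqP; rewrite -normr_eq0; apply: contraT.
rewrite -normr_gt0 normr_id => w0.
have r0 : 0 <= r by have := hp 0%N; rewrite mul0r addr0 ler0c.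
pose n := (Num.truncn (r / `|w|)).+1.
have : r < n%:R * `|w| by rewrite -ltr_pdivrMr// truncnS_gt.
rewrite ltNge; suff -> : n%:R * `|w| <= r by [].
rewrite -[X in X * _]ger0_norm// -normrM ler_norml -[- r]add0r.
move: (hp n) (hm n); rewrite -!(rmorph_nat (real_complex R) n) -!rmorphM.
by rewrite -rmorphD -rmorphB /= !ler0c => h1 h2; apply/andP; split; lra.
Qed.

(** Replacing t by nt and by -nt shows that the real-linear part vanishes for every t; then t = 1
    gives a = -b, and t = i gives 2ib = 0. *)
Lemma conj_linear_bounded_below (R : realType) (a b c : R[i]) :
  (forall t : R[i], 0 <= t^* * a + t * b + c) -> a = 0 /\ b = 0.
Proof.
move=> h.
have w0 t : t^* * a + t * b = 0.
  apply: (@archi_bound_eq0 _ _ c) => n.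
    have := h (n%:R * t); rewrite rmorphM /= conjC_nat.
    by congr (_ <= _); ring.
  have := h (- (n%:R * t)); rewrite rmorphN rmorphM /= conjC_nat.
  by congr (_ <= _); ring.
have := w0 1; rewrite rmorph1 !mul1r => /eqP; rewrite addr_eq0 => /eqP ab.
have := w0 'i; rewrite conjCi ab mulrNN -mulr2n => /eqP.
by rewrite mulrn_eq0 mulf_eq0 (negPf (neq0Ci _)) /= => /eqP ->; rewrite oppr0.
Qed.

(** * Geometry of Hilbert spaces and the Riesz representation theorem *)

Section HilbertGeometry.
Context (R : realType) (H : hilbertType R).
Implicit Types x y z : H.

Lemma innerC x y : inner x y = (inner y x)^*.
Proof. by rewrite (hermC (@inner R H)) expr0 mul1r. Qed.

Lemma innerDl x y z : inner (x + y) z = inner x z + inner y z.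
Proof. exact: linearDl. Qed.
Lemma innerDr x y z : inner x (y + z) = inner x y + inner x z.
Proof. exact: linearDr. Qed.
Lemma innerNl x y : inner (- x) y = - inner x y.
Proof. exact: linearNl. Qed.
Lemma innerNr x y : inner x (- y) = - inner x y.
Proof. exact: linearNr. Qed.
Lemma inner0l x : inner 0 x = 0.
Proof. exact: linear0l. Qed.
Lemma inner0r x : inner x 0 = 0.
Proof. exact: linear0r. Qed.
Lemma innerZl (a : R[i]) x y : inner (a *: x) y = a * inner x y.
Proof. exact: linearZl_LR. Qed.
Lemma innerZr (a : R[i]) x y : inner x (a *: y) = a^* * inner x y.
Proof. exact: linearZr_LR. Qed.

Lemma inner_ge0 x : 0 <= inner x x.
Proof. by rewrite inner_norm exprn_ge0. Qed.

Lemma inner_eq0 x : inner x x = 0 -> x = 0.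
Proof. by rewrite inner_norm => /eqP; rewrite sqrf_eq0 normr_eq0 => /eqP. Qed.

Lemma inner_injl x y : (forall z, inner x z = inner y z) -> x = y.
Proof.
move=> xy; apply/eqP; rewrite -subr_eq0; apply/eqP/inner_eq0.
by rewrite innerDl innerNl xy subrr.
Qed.

Lemma inner_injr x y : (forall z, inner z x = inner z y) -> x = y.
Proof. by move=> xy; apply: inner_injl => z; rewrite innerC xy -innerC. Qed.

Lemma norm_innerM x y : `|inner x y| <= `|x| * `|y|.
Proof.
have [->|y0] := eqVneq y 0; first by rewrite inner0r normr0 mulr_ge0.
rewrite -(@ler_pXn2r _ 2) ?nnegrE ?mulr_ge0// exprMn -!inner_norm normCK.
have yy0 : 0 < inner y y by rewrite inner_norm exprn_gt0// normr_gt0.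
(* The component of x orthogonal to y, multiplied by <y,y> to avoid a division; in the abbreviations
   below its square norm is b(ab - |c|^2). *)
have := inner_ge0 (inner y y *: x - inner x y *: y).
rewrite !innerDl !innerDr !innerNl !innerNr !innerZl !innerZr.
rewrite (innerC y x) -(innerC y y).
set a := inner x x; set b := inner y y; set c := inner x y.
rewrite (_ : _ + _ = b * (a * b - c * c^*)); last by ring.
by rewrite pmulr_rge0// subr_ge0.
Qed.

Lemma parallelogram x y :
  inner (x - y) (x - y) = 2 * inner x x + 2 * inner y y - inner (x + y) (x + y).
Proof.
rewrite !innerDl !innerDr !innerNl !innerNr.
by ring.
Qed.

Lemma inner_minP x y :
  (forall a : R[i], inner x x <= inner (x - a *: y) (x - a *: y)) ->
  inner y x = 0.
Proof.
move=> xmin; have [->|y0] := eqVneq y 0; first exact: inner0l.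
have yy0 : 0 < inner y y by rewrite inner_norm exprn_gt0// normr_gt0.
(* The coefficient of the orthogonal projection of x onto y; subtracting it lowers the square norm
   by |<y,x>|^2 / <y,y>. *)
have /= := xmin ((inner y x)^* / inner y y).
rewrite -subr_ge0 !innerDl !innerDr !innerNl !innerNr !innerZl !innerZr.
have bR : ((inner y y)^-1)^* = (inner y y)^-1.
  by apply: geC0_conj; rewrite invr_ge0 ltW.
rewrite rmorphM /= bR conjCK -(innerC x y) (innerC x y).
rewrite (_ : _ - _ = - `|inner y x| ^+ 2 / inner y y); last first.
  by rewrite normCK; field; rewrite gt_eqF.
rewrite mulNr oppr_ge0 pmulr_lle0 ?invr_gt0// => h.
by apply/eqP; rewrite -normr_eq0 -sqrf_eq0 eq_le h exprn_ge0.
Qed.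

Definition bounded_functional (f : H -> R[i]) :=
  scalar f /\ exists M : R[i], forall x, `|f x| <= M * `|x|.

(** A minimising sequence for the norm on the hyperplane f = 1 is Cauchy by the parallelogram law.
    Its limit [l] has minimal norm there, hence is orthogonal to the kernel of f, and a multiple of
    [l] represents f. *)
Lemma riesz (f : H -> R[i]) : bounded_functional f ->
  exists z, forall x, f x = inner x z.
Proof.
move=> [flin /bounded_pos[//|//|M M0 fM]].
have fD x y : f (x + y) = f x + f y by have := flin 1 x y; rewrite scale1r mul1r.
have f0 : f 0 = 0 by apply: (addrI (f 0)); rewrite -fD !addr0.
have fZ a x : f (a *: x) = a * f x by have := flin a x 0; rewrite !addr0 f0 addr0.
have fB x y : f (x - y) = f x - f y by rewrite fD -scaleN1r fZ mulN1r.
have [f_eq0|/existsNP[x0 /eqP fx0]] := pselect (forall x, f x = 0).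
  by exists 0 => x; rewrite f_eq0 inner0r.
(* Norms and inner products take values in [R[i]]; the infimum is taken in [R], hence the real
   part. *)
pose sq x : R := complex.Re (inner x x).
have sqE x : inner x x = real_complex R (sq x).
  by rewrite RRe_real// ger0_real// inner_ge0.
have sq_ge0 x : 0 <= sq x by rewrite -ler0c -sqE inner_ge0.
pose D := [set sq x | x in [set x | f x = 1]].
have D_inf : has_inf D.
  split; last by exists 0 => _ [x _ <-].
  by exists (sq ((f x0)^-1 *: x0)), ((f x0)^-1 *: x0) => //=; rewrite fZ mulVf.
pose s := inf D.
have s_le x : f x = 1 -> s <= sq x.
  by move=> fx; apply: ge_inf; [exact: D_inf.2|exists x].
have s_ge0 : 0 <= s by apply: lb_le_inf; [exact: D_inf.1|move=> _ [x _ <-]].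
have /choice[u uP] : forall n : nat, exists x, f x = 1 /\ sq x < s + n.+1%:R^-1.
  move=> n; have n0 : 0 < n.+1%:R^-1 :> R by [].
  by have [_ [x fx <-] xlt] := inf_adherent n0 D_inf; exists x.
(* The midpoint [w] of [u m] and [u n] also satisfies f w = 1, so the term |u m + u n|^2 = 4 |w|^2
   of the parallelogram law is at least 4s. *)
have u_cauchy m n : sq (u m - u n) <= 2 * m.+1%:R^-1 + 2 * n.+1%:R^-1.
  have := parallelogram (u m) (u n).
  rewrite (_ : u m + u n = 2 *: (2^-1 *: (u m + u n))); last first.
    by rewrite scalerA divff ?scale1r// pnatr_eq0.
  set w := 2^-1 *: _.
  have /s_le sw : f w = 1.
    by rewrite fZ fD (uP m).1 (uP n).1 mulVf// pnatr_eq0.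
  rewrite innerZl innerZr !sqE conjC_nat.
  rewrite -(rmorph_nat (real_complex R) 2) -!rmorphM -rmorphD -rmorphB.
  move=> /complexI ->.
  move: (uP m).2 (uP n).2 sw.
  move: (sq (u m)) (sq (u n)) (sq w) (m.+1%:R^-1) (n.+1%:R^-1).
  by move=> a b c i j; lra.
have u_cvg : cvg (u @ \oo).
  apply: cauchy_cvg; apply: cauchy_exP => _ /cplx_gt0[e e0 ->].
  (* With both inverses below e^2/4, the bound of [u_cauchy] is below e^2. *)
  have [|N hN] := @invSn_lt R (e ^+ 2 / 4); first by rewrite divr_gt0// exprn_gt0.
  exists (u N); exists N => // n /= Nn; rewrite -ball_normE /ball_ /=.
  have : inner (u N - u n) (u N - u n) < real_complex R e ^+ 2.
    rewrite sqE -rmorphXn ltcR (le_lt_trans (u_cauchy _ _))//.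
    move: (hN _ (leqnn N)) (hN _ Nn); move: (N.+1%:R^-1) (n.+1%:R^-1).
    by move=> a b; lra.
  by rewrite inner_norm ltr_pXn2r ?nnegrE ?normr_ge0 ?ler0c ?ltW.
pose l := lim (u @ \oo).
have /cvgrPdist_lt ul : u @ \oo --> l by exact: u_cvg.
have fl : f l = 1.
  apply/eqP; apply: contraT; rewrite -subr_eq0 -normr_gt0 => fl1.
  have [N _ /(_ N (leqnn N)) uN] := ul _ (divr_gt0 fl1 M0).
  suff : `|f l - 1| < `|f l - 1| by rewrite ltxx.
  rewrite -{1}(uP N).1 -fB (le_lt_trans (fM _))// mulrC.
  by rewrite -ltr_pdivlMr.
have sql : sq l <= s.
  rewrite leNgt; apply/negP => sl.
  pose a := complex.Re `|l|.
  have aE : `|l| = real_complex R a by rewrite RRe_real// ger0_real.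
  have a2 : a ^+ 2 = sq l.
    by apply: complexI; rewrite -sqE inner_norm aE rmorphXn.
  have a0 : 0 < a.
    rewrite -ltr0c -aE normr_gt0; apply/eqP => l0; move: fl => /eqP.
    by rewrite l0 f0 eq_sym oner_eq0.
  (* Once |l - u n| < e, [sqr_gap] bounds [sq (u n)] below by s + (sq l - s)/2, whereas for large n
     the choice of [u] puts it strictly below that value. *)
  pose e := (sq l - s) / (4 * a).
  have e0 : 0 < e by rewrite divr_gt0// ?subr_gt0// mulr_gt0.
  have ea : a * e = (sq l - s) / 4 by rewrite /e; field; rewrite gt_eqF.
  have [N1 _ hN1] : \forall n \near \oo, `|l - u n| < real_complex R e.
    by apply: ul; rewrite ltr0c.
  have [|N2 hN2] := @invSn_lt R ((sq l - s) / 2).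
    by rewrite divr_gt0// subr_gt0.
  pose n := maxn N1 N2.
  have := hN1 n (leq_maxl _ _); have := hN2 n (leq_maxr _ _).
  have := (uP n).2.
  move=> un sn ln.
  have ae : a - e < complex.Re `|u n|.
    rewrite -ltcR (@RRe_real _ `|u n|) ?ger0_real// [X in X < _]rmorphB /= -aE ltrBlDr.
    rewrite -{1}(subrK (u n) l) (le_lt_trans (ler_normD _ _))// addrC.
    by rewrite ltrD2l.
  have : (complex.Re `|u n|) ^+ 2 = sq (u n).
    apply: complexI; by rewrite -sqE inner_norm rmorphXn /= RRe_real// ger0_real.
  by move=> /(sqr_gap s_ge0 a2 a0 ea ae); rewrite leNgt (lt_trans un)// ltrD2l.
have lmin w : f w = 0 -> inner w l = 0.
  move=> fw; apply: inner_minP => t; rewrite !sqE lecR (le_trans sql)//.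
  by apply: s_le; rewrite fB fl fZ fw mulr0 subr0.
have ll0 : inner l l != 0.
  apply/eqP => /inner_eq0 l0; move: fl => /eqP.
  by rewrite l0 f0 eq_sym oner_eq0.
(* As f l = 1, the vector x - f(x) l lies in the kernel of f, so <x,l> = f(x) <l,l>. *)
exists ((inner l l)^-1 *: l) => x.
rewrite innerZr geC0_conj ?invr_ge0 ?inner_ge0//.
have : inner (x - f x *: l) l = 0 by apply: lmin; rewrite fB fZ fl mulr1 subrr.
rewrite innerDl innerNl innerZl => /eqP; rewrite subr_eq0 => /eqP ->.
by rewrite mulrCA mulVf// mulr1.
Qed.
End HilbertGeometry.

(** * Linear maps, bounded operators and adjoints *)

Section LinearProp.
Context (K : pzRingType) (U V : lmodType K) (T : U -> V) (T_lin : linear T).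

Lemma linear_add x y : T (x + y) = T x + T y.
Proof. by have := T_lin 1 x y; rewrite !scale1r. Qed.

Lemma linear_zero : T 0 = 0.
Proof. by apply: (addrI (T 0)); rewrite -linear_add !addr0. Qed.

Lemma linear_scale a x : T (a *: x) = a *: T x.
Proof. by have := T_lin a x 0; rewrite !addr0 linear_zero addr0. Qed.

Lemma linear_sub x y : T (x - y) = T x - T y.
Proof. by rewrite linear_add -scaleN1r linear_scale scaleN1r. Qed.
End LinearProp.

Section BoundedOperators.
Context (R : realType).
Implicit Types H K L : hilbertType R.

Lemma bounded_opP H K (T : H -> K) : bounded_op T ->
  exists2 M : R[i], 0 < M & forall x, `|T x| <= M * `|x|.
Proof. by move=> [_ /bounded_pos]; apply=> x; exact: normr_ge0. Qed.

Lemma bounded_op_id H : bounded_op (@idfun H).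
Proof. by split=> //; exists 1 => x; rewrite mul1r. Qed.

Lemma bounded_op_comp H K L (S : K -> L) (T : H -> K) :
  bounded_op S -> bounded_op T -> bounded_op (S \o T).
Proof.
move=> bS bT; have [M M0 SM] := bounded_opP bS; have [N N0 TN] := bounded_opP bT.
split; first by move=> a x y /=; rewrite bT.1 bS.1.
exists (M * N) => x; rewrite (le_trans (SM _))// -mulrA ler_pM2l//.
Qed.

Lemma bounded_op_lin H K (a : R[i]) (S T : H -> K) :
  bounded_op S -> bounded_op T -> bounded_op (a *: S + T).
Proof.
move=> bS bT; have [M M0 SM] := bounded_opP bS; have [N N0 TN] := bounded_opP bT.
have E x : (a *: S + T) x = a *: S x + T x by [].
split.
  move=> b x y; rewrite !E bS.1 bT.1 !scalerDr !scalerA (mulrC a b).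
  by rewrite addrACA.
exists (`|a| * M + N) => x; rewrite E (le_trans (ler_normD _ _))// mulrDl.
by rewrite lerD// normrZ -mulrA ler_wpM2l.
Qed.

(** Riesz applied to x |-> <Tx, y> yields T'y. The bound on T' comes from |T'y|^2 = <TT'y, y> <= M
    |T'y| |y| by cancelling |T'y|, so T'y = 0 is treated apart. *)
Lemma adjoint_exists H K (T : H -> K) : bounded_op T ->
  exists T', is_adjoint T T'.
Proof.
move=> bT; have [M M0 TM] := bounded_opP bT.
have /choice[T' T'E] : forall y, exists z, forall x, inner (T x) y = inner x z.
  move=> y; apply: (@riesz _ _ (fun x => inner (T x) y)); split.
    by move=> a x z; rewrite bT.1 innerDl innerZl.
  exists (M * `|y|) => x; rewrite (le_trans (norm_innerM _ _))//.
  by rewrite mulrAC ler_wpM2r.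
exists T'; split=> //; split.
  move=> a x y; apply: inner_injr => z.
  by rewrite -T'E !innerDr !innerZr -!T'E.
exists M => y; have [->|T'y0] := eqVneq (T' y) 0.
  by rewrite normr0 mulr_ge0// ltW.
rewrite -(@ler_pM2r _ `|T' y|) ?normr_gt0// -expr2 -inner_norm.
rewrite -(ger0_norm (inner_ge0 (T' y))) -T'E (le_trans (norm_innerM _ _))//.
by rewrite mulrAC ler_wpM2r.
Qed.

Lemma is_adjointC H K (T : H -> K) T' : bounded_op T -> is_adjoint T T' ->
  is_adjoint T' T.
Proof.
by move=> bT [_ TT']; split=> // x y; rewrite innerC -TT' -innerC.
Qed.

Lemma is_adjoint_unique H K (T : H -> K) T' T'' :
  is_adjoint T T' -> is_adjoint T T'' -> T' = T''.
Proof.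
move=> [_ h1] [_ h2]; apply/funext => y; apply: inner_injr => x.
by rewrite -h1 h2.
Qed.

Lemma is_adjoint_comp H K L (S : K -> L) (T : H -> K) S' T' :
  is_adjoint S S' -> is_adjoint T T' -> is_adjoint (S \o T) (T' \o S').
Proof.
move=> [bS hS] [bT hT]; split; first exact: bounded_op_comp.
by move=> x y /=; rewrite hS hT.
Qed.

(** If f x were nonzero, the ball around x of radius |f x| / M would contain some y in the span;
    then f y = 0 and |f x| = |f(x - y)| < |f x|. *)
Lemma dense_functional_eq0 H (f : H -> R[i]) (S : set H) :
  bounded_functional f -> dense (lin_span S) -> (forall x, S x -> f x = 0) ->
  forall x, f x = 0.
Proof.
move=> [flin /bounded_pos[//|//|M M0 fM]] Sd fS x.
apply/eqP; apply: contraT; rewrite -normr_gt0 => fx0.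
have e0 := divr_gt0 fx0 M0.
have [||y [xy [n [c [v [vS yE]]]]]] := Sd (ball x (`|f x| / M)).
- by exists x; exact: ballxx.
- exact: ball_open.
have fy : f y = 0.
  have fD u w : f (u + w) = f u + f w.
    by have := flin 1 u w; rewrite scale1r mul1r.
  have f0 : f 0 = 0 by apply: (addrI (f 0)); rewrite -fD !addr0.
  rewrite yE; elim/big_ind: _ => // [u w fu fw|i _]; first by rewrite fD fu fw addr0.
  by rewrite -[_ *: _]addr0 flin f0 addr0 fS ?mulr0.
have fxy : f x = f (x - y).
  by have := flin (-1) y x; rewrite fy mulr0 add0r scaleN1r addrC.
suff : `|f x| < `|f x| by rewrite ltxx.
rewrite {1}fxy (le_lt_trans (fM _))// mulrC -ltr_pdivlMr//.
by move: xy; rewrite -ball_normE.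
Qed.

End BoundedOperators.

(** * Operator systems, and completely positive maps fixing a projection *)

Section OperatorSystems.
Context (R : realType).
Implicit Types K : hilbertType R.

Definition operator_system K (S : set (K -> K)) :=
  [/\ S idfun,
      forall (a : R[i]) x y, S x -> S y -> S (a *: x + y),
      forall x, S x -> bounded_op x &
      forall x x', S x -> is_adjoint x x' -> S x'].

Lemma operator_systemB K (S : set (K -> K)) x y :
  operator_system S -> S x -> S y -> S (x - y).
Proof. by move=> [_ lS _ _] Sx Sy; rewrite -scaleN1r addrC; exact: lS. Qed.

Lemma operator_system0 K (S : set (K -> K)) : operator_system S -> S 0.
Proof.
by move=> oS; rewrite -(subrr idfun); case: (oS) => ? *; exact: operator_systemB.
Qed.

Lemma completely_positiveB K K' (S : set (K -> K)) (T : set (K' -> K')) theta x y :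
  completely_positive S T theta -> S x -> S y -> theta (x - y) = theta x - theta y.
Proof.
by move=> [_ l _] Sx Sy; rewrite -scaleN1r addrC l// scaleN1r addrC.
Qed.

Lemma completely_positive0 K K' (S : set (K -> K)) (T : set (K' -> K')) theta :
  operator_system S -> completely_positive S T theta -> theta 0 = 0.
Proof.
move=> oS cp; have S0 := operator_system0 oS.
by rewrite -{1}(subrr (0 : K -> K)) (completely_positiveB cp)// subrr.
Qed.

(* Apply theta to the positive matrix [[q, qx], [x*q, M^2]], and test the result
   on the vectors (t h, k): the diagonal contributes a term independent of t. *)
Lemma ucp_off_diagonal K K' (S : set (K -> K)) (T : set (K' -> K')) theta
    q x x' h k :
  operator_system S -> (forall y, T y -> linear y) -> ucp S T theta ->
  S q -> q \o q = q -> is_adjoint q q ->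
  bounded_op x -> is_adjoint x x' -> S (q \o x) -> S (x' \o q) ->
  theta q h = 0 ->
  inner (theta (q \o x) k) h = 0 /\ inner (theta (x' \o q) h) k = 0.
Proof.
move=> oS Tlin [cp th1] Sq qq [_ q_adj] bx [_ xx'] Sqx Sxq qh0.
have [M M0 xM] := bounded_opP bx.
have [S1 Slin _ _] := oS; have [thST thlin thpos] := cp.
pose c := M ^+ 2.
have S0 := operator_system0 oS.
have qqE z : q (q z) = q z by rewrite -{3}qq.
have Sc : S (c *: idfun).
  by rewrite -[_ *: _]addr0; exact: Slin.
have thc : theta (c *: idfun) = c *: idfun.
  by rewrite -[c *: _]addr0 thlin// (completely_positive0 oS cp) th1 addr0.
pose m (i j : 'I_2) : K -> K := if i == ord0
  then if j == ord0 then q else q \o x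
  else if j == ord0 then x' \o q else c *: idfun.
have Sm i j : S (m i j) by rewrite /m; do 2 case: ifP => _.
have m_pos : mx_positive m.
  move=> v; rewrite !big_ord_recl !big_ord0 /m /= !addr0.
  set u := v ord0; set w := v _.
  have -> : (c *: idfun) w = c *: w by [].
  rewrite !innerDl innerZl.
  have -> : inner (q u) u = inner (q u) (q u) by rewrite -[in LHS]qqE q_adj.
  have -> : inner (q (x w)) u = inner (x w) (q u) by rewrite q_adj.
  have -> : inner (x' (q u)) w = inner (q u) (x w) by rewrite innerC -xx' -innerC.
  (* Completing the square: the form is |qu + xw|^2 plus M^2 |w|^2 - |xw|^2, which is nonnegative by
     the choice of [M]. *)
  have -> : inner (q u) (q u) + inner (x w) (q u) +
      (inner (q u) (x w) + c * inner w w) =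
      inner (q u + x w) (q u + x w) + (c * inner w w - inner (x w) (x w)).
    by rewrite !innerDl !innerDr; ring.
  rewrite addr_ge0 ?inner_ge0// subr_ge0 !inner_norm -exprMn.
  by rewrite ler_pXn2r// ?nnegrE ?mulr_ge0// ltW.
apply: (@conj_linear_bounded_below _ _ _ (c * inner k k)) => t.
pose v (i : 'I_2) := if i == ord0 then t *: h else k.
have := thpos 2%N m Sm m_pos v.
rewrite !big_ord_recl !big_ord0 /m /v /= !addr0 thc.
rewrite (linear_scale (Tlin _ (thST _ Sq))) qh0 scaler0 add0r.
rewrite (linear_scale (Tlin _ (thST _ Sxq))) innerDl innerZl innerZr addrA.
by rewrite -[(c *: idfun) k]/(c *: k) innerZl.
Qed.

Section FixedProjection.
Context K (S : set (K -> K)) (theta : (K -> K) -> K -> K) (p : K -> K).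
Hypotheses (oS : operator_system S) (theta_ucp : ucp S S theta).
Hypotheses (Sp : S p) (thp : theta p = p) (pp : p \o p = p).
Hypothesis p_adj : is_adjoint p p.

Let q := idfun - p.
Let Slin_op y : S y -> linear y.
Proof. by move=> Sy; case: oS => _ _ /(_ _ Sy)[]. Qed.
Let bS y : S y -> bounded_op y. Proof. by case: oS => _ _ + _; apply. Qed.
Let S1 : S idfun. Proof. by case: oS. Qed.
Let Sq : S q. Proof. exact: operator_systemB. Qed.
Let thq : theta q = q.
Proof. by rewrite (completely_positiveB theta_ucp.1)// thp theta_ucp.2. Qed.
Let ppE h : p (p h) = p h. Proof. by rewrite -[in RHS]pp. Qed.
Let pq0 h : p (q h) = 0.
Proof. by rewrite (linear_sub (Slin_op Sp)) /= ppE subrr. Qed.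
Let qp0 h : q (p h) = 0.
Proof. by rewrite -[LHS]/(p h - p (p h)) ppE subrr. Qed.
Let qq : q \o q = q.
Proof. by apply/funext => h /=; rewrite -[LHS]/(q h - p (q h)) pq0 subr0. Qed.
Let q_adj : is_adjoint q q.
Proof.
split=> [|h k]; first exact: bS.
rewrite -[q h]/(h - p h) -[q k]/(k - p k) innerDl innerDr innerNl innerNr.
by rewrite p_adj.2.
Qed.
Let pDq h : h = p h + q h. Proof. by rewrite -[q h]/(h - p h) addrC subrK. Qed.

(** Since theta fixes q and q kills p h, [ucp_off_diagonal] gives p theta(qx) = 0; with p and q
    exchanged, q theta(px) = 0. An operator system need not be closed under products, so membership
    of p x is assumed. *)
Lemma ucp_projection_mul x : S x -> S (p \o x) -> theta (p \o x) = p \o theta x.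
Proof.
move=> Sx Spx; have [x' xx'] := adjoint_exists (bS Sx).
have Sadj y y' : S y -> is_adjoint y y' -> S y' by case: oS => _ _ _; apply.
have qxE : q \o x = x - (p \o x) by [].
have Sqx : S (q \o x) by rewrite qxE; exact: operator_systemB.
have Sx'p : S (x' \o p) by apply: Sadj Spx _; exact: is_adjoint_comp.
have Sx'q : S (x' \o q) by apply: Sadj Sqx _; exact: is_adjoint_comp.
have ortho1 k : p (theta (q \o x) k) = 0.
  apply: inner_injl => h; rewrite p_adj.2 inner0l.
  have [] // := @ucp_off_diagonal _ _ S S theta q x x' (p h) k oS.
  - exact: bS.
  - by rewrite thq qp0.
have ortho2 k : q (theta (p \o x) k) = 0.
  apply: inner_injl => h; rewrite q_adj.2 inner0l.
  have [] // := @ucp_off_diagonal _ _ S S theta p x x' (q h) k oS.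
  - exact: bS.
  - by rewrite thp pq0.
apply/funext => k /=; rewrite [LHS]pDq ortho2 addr0.
have -> : theta x = theta (p \o x) + theta (q \o x).
  by rewrite qxE (completely_positiveB theta_ucp.1)// addrC subrK.
rewrite -[(_ + _) k]/(theta (p \o x) k + theta (q \o x) k).
by rewrite (linear_add (Slin_op Sp)) ortho1 addr0.
Qed.

(** The second conclusion of [ucp_off_diagonal] is used with the adjoint [y] of x in place of x, so
    that its own adjoint is x again; q y and p y lie in S as adjoints of x q and x p. *)
Lemma ucp_mul_projection x : S x -> S (x \o p) -> theta (x \o p) = theta x \o p.
Proof.
move=> Sx Sxp; have [y xy] := adjoint_exists (bS Sx).
have yx := is_adjointC (bS Sx) xy.
have Sadj z z' : S z -> is_adjoint z z' -> S z' by case: oS => _ _ _; apply.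
have Sy : S y by exact: Sadj xy.
have thS z : S z -> S (theta z) by case: theta_ucp => -[+ _ _] _; apply.
have xqE : x \o q = x - (x \o p).
  by apply/funext => h /=; rewrite -[q h]/(h - p h) (linear_sub (Slin_op Sx)).
have Sxq : S (x \o q) by rewrite xqE; exact: operator_systemB.
have Spy : S (p \o y) by apply: Sadj Sxp _; exact: is_adjoint_comp.
have Sqy : S (q \o y) by apply: Sadj Sxq _; exact: is_adjoint_comp.
have ortho1 h : theta (x \o q) (p h) = 0.
  apply: inner_injl => k; rewrite inner0l.
  have [] // := @ucp_off_diagonal _ _ S S theta q y x (p h) k oS.
  - exact: bS.
  - by rewrite thq qp0.
have ortho2 h : theta (x \o p) (q h) = 0.
  apply: inner_injl => k; rewrite inner0l.
  have [] // := @ucp_off_diagonal _ _ S S theta p y x (q h) k oS.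
  - exact: bS.
  - by rewrite thp pq0.
apply/funext => h /=; rewrite [in LHS](pDq h) (linear_add (Slin_op (thS _ Sxp))).
rewrite ortho2 addr0.
have -> : theta x = theta (x \o p) + theta (x \o q).
  by rewrite xqE (completely_positiveB theta_ucp.1)// addrC subrK.
rewrite -[RHS]/(theta (x \o p) (p h) + theta (x \o q) (p h)).
by rewrite ortho1 addr0.
Qed.

End FixedProjection.

Lemma ucp_comp K K' K'' (S : set (K -> K)) (S' : set (K' -> K'))
    (S'' : set (K'' -> K'')) phi psi :
  ucp S S' phi -> ucp S' S'' psi -> ucp S S'' (psi \o phi).
Proof.
move=> [[phiS phil phip] phi1] [[psiS psil psip] psi1]; split; last first.
  by rewrite /= phi1.
split.
- by move=> x Sx; apply/psiS/phiS.
- by move=> a x y Sx Sy /=; rewrite phil// psil//; exact: phiS.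
- move=> n x Sx x0; apply: (psip n (fun i j => phi (x i j))).
    by move=> i j; exact: phiS.
  exact: phip.
Qed.

Lemma faithful_unital_rep_operator_system (B : starAlgType R) K (pi : B -> K -> K) :
  faithful_unital_rep pi -> operator_system (range pi).
Proof.
move=> [bpi pil [pi1 _] pi_adj _]; split.
- by exists 1.
- by move=> a _ _ [x _ <-] [y _ <-]; exists (alg_scalar a * x + y).
- by move=> _ [x _ <-].
- move=> _ x' [x _ <-] xx'; exists (star x) => //.
  exact: is_adjoint_unique (pi_adj x) xx'.
Qed.

End OperatorSystems.

(** * Matrix entries and matrix units in the Fubini tensor product *)

Section Fubini.
Context (R : realType) (H K HK : hilbertType R) (t : H -> K -> HK).
Context (A : Type) (e : A -> H).
Hypotheses (t_tensor : hilbert_tensor t) (e_basis : orthonormal_basis e).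

Let tl h : linear (t h). Proof. by case: t_tensor => -[]. Qed.
Let tr k : linear (t ^~ k). Proof. by case: t_tensor => -[]. Qed.
Let tt h k h' k' : inner (t h k) (t h' k') = inner h h' * inner k k'.
Proof. by case: t_tensor. Qed.

Let norm_t h k : `|t h k| = `|h| * `|k|.
Proof.
apply/eqP; rewrite -(@eqrXn2 _ 2) ?mulr_ge0// exprMn -!inner_norm; exact/eqP/tt.
Qed.

Lemma tensor_bounded_op h : bounded_op (t h).
Proof. by split=> //; exists `|h| => k; rewrite norm_t. Qed.

(** Two density arguments: elementary tensors span a dense subspace of HK, and for fixed k the
    functional h |-> f(h (x) k) is bounded and vanishes on the basis. *)
Lemma tensor_basis_functional_eq0 (f : HK -> R[i]) : bounded_functional f ->
  (forall a k, f (t (e a) k) = 0) -> forall x, f x = 0.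
Proof.
move=> bf fe; have [_ _ td] := t_tensor; have [_ _ ed] := e_basis.
apply: (dense_functional_eq0 bf td) => _ [h _ [k _ <-]].
apply: (@dense_functional_eq0 _ _ (fun h => f (t h k))) ed _ h; last first.
  by move=> _ [a _ <-].
case: bf => fl /bounded_pos[//|//|M M0 fM]; split.
  by move=> c x y; rewrite (tr k c x y) fl.
exists (M * `|k|) => h; rewrite (le_trans (fM _))// norm_t.
by rewrite (mulrC `|h|) mulrA.
Qed.

(* The adjoint J_a^* of k |-> e_a (x) k. *)
Definition coord (a : A) : HK -> K :=
  xget (fun _ => 0) [set J | is_adjoint (t (e a)) J].

Lemma coord_adjoint a : is_adjoint (t (e a)) (coord a).
Proof.
rewrite /coord; have [J tJ] := adjoint_exists (tensor_bounded_op (e a)).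
exact: (xgetPex (fun _ => 0) (ex_intro _ J tJ)).
Qed.

Lemma coord_bounded_op a : bounded_op (coord a).
Proof. by case: (coord_adjoint a). Qed.

Lemma coordK a : coord a \o t (e a) = idfun.
Proof.
apply/funext => k; apply: inner_injr => k' /=.
rewrite -(coord_adjoint a).2 tt; case: e_basis => -> _ _; exact: mul1r.
Qed.

Lemma coord_ortho a b : a <> b -> coord a \o t (e b) = fun _ => 0.
Proof.
move=> ab; apply/funext => k; apply: inner_injr => k' /=.
rewrite -(coord_adjoint a).2 tt inner0r; case: e_basis => _ eo _.
by rewrite eo// mul0r.
Qed.

Lemma coord_tensor a h k : coord a (t h k) = inner h (e a) *: k.
Proof.
apply: inner_injl => k'; rewrite innerC -(coord_adjoint a).2 -innerC tt.
by rewrite innerZl.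
Qed.

(* E_ab (x) s. *)
Definition munit (a b : A) (s : K -> K) : HK -> HK := t (e a) \o s \o coord b.

Lemma munit_bounded_op a b s : bounded_op s -> bounded_op (munit a b s).
Proof.
move=> bs; apply: bounded_op_comp (coord_bounded_op b).
by apply: bounded_op_comp bs; exact: tensor_bounded_op.
Qed.

Definition rank_one (h h' : H) : H -> H := fun x => inner x h' *: h.

Lemma rank_one_bounded_op h h' : bounded_op (rank_one h h').
Proof.
split; first by move=> a x y; rewrite /rank_one innerDl innerZl scalerDl scalerA.
exists (`|h'| * `|h|) => x; rewrite normrZ.
by rewrite (mulrC `|h'|) -mulrA mulrC ler_wpM2l// mulrC norm_innerM.
Qed.

(** With this, [extends_id_odot] determines the value of an extension on every [munit]. *)
Lemma munit_is_sum_tensor a b s : bounded_op s ->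
  is_sum_tensor t (fun _ : 'I_1 => rank_one (e a) (e b)) (fun=> s) (munit a b s).
Proof.
move=> bs; split=> [|h k]; first exact: munit_bounded_op.
rewrite big_ord1 /munit /rank_one /= coord_tensor (linear_scale bs.1).
by rewrite (linear_scale (tl _)) -(linear_scale (tr _)).
Qed.

Section System.
Context (S : set (K -> K)) (oS : operator_system S).

(** Adjoints are unique, so the existential one in [fubini] is [coord a]. *)
Lemma fubiniE x : fubini t e S x <->
  bounded_op x /\ forall a b, S (coord a \o x \o t (e b)).
Proof.
split=> -[bx xS]; split=> // a b.
  have [J [tJ]] := xS a b.
  by rewrite (is_adjoint_unique tJ (coord_adjoint a)).
by exists (coord a); split=> //; exact: coord_adjoint.
Qed.

Lemma fubini_operator_system : operator_system (fubini t e S).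
Proof.
have [S1 Slin Sb Sadj] := oS; have S0 := operator_system0 oS.
split.
- apply/fubiniE; split=> [|a b]; first exact: bounded_op_id.
  rewrite -[_ \o t (e b)]/(coord a \o t (e b)).
  by have [->|ab] := pselect (a = b); rewrite ?coordK// coord_ortho.
- move=> c x y /fubiniE[bx xS] /fubiniE[bY yS]; apply/fubiniE.
  split=> [|a b]; first exact: bounded_op_lin.
  rewrite (_ : _ \o t _ =
      c *: (coord a \o x \o t (e b)) + (coord a \o y \o t (e b))).
    exact: Slin.
  by apply/funext => k /=; rewrite -[LHS]/(coord a (c *: _ + _)) (coord_bounded_op a).1.
- by move=> x /fubiniE[].
- move=> x x' /fubiniE[bx xS] xx'; apply/fubiniE; split=> [|a b].
    by case: xx'.
  (* The (a, b) entry of the adjoint of x is the adjoint of the (b, a) entry of x. *)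
  apply: Sadj (xS b a) _; apply: is_adjoint_comp (coord_adjoint a).
  apply: is_adjoint_comp xx'.
  by apply: is_adjointC (coord_adjoint b); exact: tensor_bounded_op.
Qed.

Lemma fubini_munit a b s : S s -> fubini t e S (munit a b s).
Proof.
move=> Ss; have [S1 Slin Sb Sadj] := oS; have S0 := operator_system0 oS.
have bs := Sb _ Ss.
apply/fubiniE; split=> [|c d]; first exact: munit_bounded_op.
rewrite (_ : _ \o t _ = (coord c \o t (e a)) \o s \o (coord b \o t (e d)))//.
have [->|ca] := pselect (c = a); last first.
  by rewrite coord_ortho.
have [->|bd] := pselect (b = d); first by rewrite !coordK.
rewrite coordK coord_ortho// (_ : _ \o _ = 0)//.
by apply/funext => k /=; exact: linear_zero bs.1.
Qed.

End System.
End Fubini.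

(** * Rigidity of unital completely positive maps fixing the matrix units *)

Section Uniqueness.
Context (R : realType) (H K HK : hilbertType R) (t : H -> K -> HK).
Context (A : Type) (e : A -> H).
Hypotheses (t_tensor : hilbert_tensor t) (e_basis : orthonormal_basis e).
Context (S : set (K -> K)) (oS : operator_system S).
Context (theta : (HK -> HK) -> HK -> HK).
Local Notation F := (fubini t e S).
Local Notation coord := (coord t e).
Local Notation munit := (munit t e).

Lemma ucp_fubini_id : ucp F F theta ->
  (forall a b s, S s -> theta (munit a b s) = munit a b s) ->
  forall x, F x -> theta x = x.
Proof.
move=> th_ucp thE x Fx.
have oF : operator_system F by exact: fubini_operator_system.
have [S1 _ Sb _] := oS; have [_ _ Fb _] := oF.
have S0 := operator_system0 oS.
pose p a := munit a a idfun.
have Fp a : F (p a) by exact: fubini_munit.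
have cK := coordK t_tensor e_basis; have cO := coord_ortho t_tensor e_basis.
have cKE a k : coord a (t (e a) k) = k := congr1 (@^~ k) (cK a).
have pp a : p a \o p a = p a by apply/funext => z; rewrite /p /munit /= cKE.
have bt h := tensor_bounded_op t_tensor h.
have bc a := coord_bounded_op e t_tensor a.
have p_adj a : is_adjoint (p a) (p a).
  have c_adj := coord_adjoint e t_tensor a.
  exact: is_adjoint_comp c_adj (is_adjointC (bt _) c_adj).
have thx : F (theta x) by case: th_ucp => -[+ _ _] _; apply.
(* Multiplying by p_b on the right keeps the entries of column b and replaces all others by 0. *)
have Fmul_p y b : F y -> F (y \o p b).
  move=> /(fubiniE e t_tensor)[bY yS]; apply/(fubiniE e t_tensor); split=> [|c d].
    by apply: bounded_op_comp bY _; exact: Fb.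
  have [->|bd] := pselect (b = d).
    rewrite (_ : _ \o t _ = coord c \o y \o t (e d))//.
    by apply/funext => k; rewrite /p /munit /= cKE.
  rewrite (_ : _ \o t _ = 0)//; apply/funext => k.
  rewrite /p /munit /= -[coord b _]/((coord b \o t (e d)) k) cO//.
  by rewrite (linear_zero (bt _).1) (linear_zero bY.1) (linear_zero (bc _).1).
have Fp_mul y a : F y -> F (p a \o y).
  move=> /(fubiniE e t_tensor)[bY yS]; apply/(fubiniE e t_tensor); split=> [|c d].
    by apply: bounded_op_comp bY; exact: Fb.
  have [->|ca] := pselect (c = a).
    rewrite (_ : _ \o t _ = coord a \o y \o t (e d))//.
    by apply/funext => k; rewrite /p /munit /= cKE.
  rewrite (_ : _ \o t _ = 0)//; apply/funext => k.
  by rewrite /p /munit /= -[LHS]/((coord c \o t (e a)) _) cO.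
have key a b : p a \o (theta x \o p b) = p a \o (x \o p b).
  have Fxp : F (x \o p b) by exact: Fmul_p.
  have thp c : theta (p c) = p c by exact: thE.
  have <- : theta (x \o p b) = theta x \o p b.
    exact: (ucp_mul_projection oF th_ucp).
  have <- : theta (p a \o (x \o p b)) = p a \o theta (x \o p b).
    by apply: (ucp_projection_mul oF th_ucp) => //; exact: Fp_mul.
  have [_ xS] := (fubiniE e t_tensor S x).1 Fx.
  (* By unfolding, p_a x p_b is the matrix unit E_ab tensored with the (a, b) entry of x. *)
  exact: thE (xS a b).
(* Compressing [key] by J_a^* on the left and J_b on the right removes the projections. *)
have coordE a b k : coord a (theta x (t (e b) k)) = coord a (x (t (e b) k)).
  have := congr1 (fun y => coord a (y (t (e b) k))) (key a b).
  by rewrite /p /munit /= !cKE.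
apply/funext => z; apply: inner_injl => w; apply/eqP; rewrite -subr_eq0; apply/eqP.
rewrite -innerNl -innerDl; move: w.
have bD : bounded_op (theta x - x).
  by rewrite -scaleN1r addrC; apply: bounded_op_lin; exact: Fb.
rewrite -[theta x z - x z]/((theta x - x) z); set D := theta x - x in bD *.
(* The density of basis tensors is used twice: here for the test vector w, and below for the
   argument of [D]. *)
have D0 b k : D (t (e b) k) = 0.
  apply: inner_injl => w; rewrite inner0l innerC.
  rewrite (_ : inner w _ = 0) ?rmorph0//; move: w.
  apply: (tensor_basis_functional_eq0 t_tensor e_basis) => [|a k'].
    split; first by move=> c u v; rewrite innerDl innerZl.
    by exists `|D (t (e b) k)| => u; rewrite mulrC norm_innerM.
  rewrite (coord_adjoint e t_tensor a).2.
  rewrite -[D _]/(_ - _) (linear_sub (bc a).1) coordE subrr.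
  by rewrite inner0r.
move=> w; have [M M0 DM] := bounded_opP bD.
apply: (tensor_basis_functional_eq0 t_tensor e_basis (f := fun z => inner (D z) w)).
  split; first by move=> c u v; rewrite bD.1 innerDl innerZl.
  exists (M * `|w|) => u; rewrite (le_trans (norm_innerM _ _))// mulrAC.
  by rewrite ler_wpM2r.
by move=> a k; rewrite D0 inner0l.
Qed.
End Uniqueness.

(** * The map induced by a lifting *)

Theorem proposition3p5 (R : realType)
    (d : measure_display) (X : measurableType d)
    (mu : {measure set X -> \bar R}) (mu_complete : measure_is_complete mu)
    (H : hilbertType R) (A : Type) (e : A -> H) (e_basis : orthonormal_basis e)
    (KM HKM KL HKL : hilbertType R)
    (tM : H -> KM -> HKM) (tM_tensor : hilbert_tensor tM)
    (tL : H -> KL -> HKL) (tL_tensor : hilbert_tensor tL)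
    (piM : bmfun X R -> KM -> KM) (piM_rep : faithful_unital_rep piM)
    (piL : Linf mu -> KL -> KL) (piL_rep : faithful_unital_rep piL)
    (id_q : (HKM -> HKM) -> (HKL -> HKL))
    (id_q_ucp : ucp (fubini tM e (range piM)) (fubini tL e (range piL)) id_q)
    (id_q_ext : extends_id_odot tM tL piM piL (@Linf_class d X R mu) id_q)
    (rho : Linf mu -> bmfun X R) (rho_lifting : lifting rho)
    (id_rho : (HKL -> HKL) -> (HKM -> HKM))
    (id_rho_ucp :
      ucp (fubini tL e (range piL)) (fubini tM e (range piM)) id_rho)
    (id_rho_ext : extends_id_odot tL tM piL piM rho id_rho) :
  unital_complete_order_embedding
    (fubini tL e (range piL)) (fubini tM e (range piM)) id_rho /\
  (forall x, fubini tL e (range piL) x -> id_q (id_rho x) = x).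
Proof.
have oL := faithful_unital_rep_operator_system piL_rep.
have [bM _ _ _ _] := piM_rep; have [bL _ _ _ _] := piL_rep.
have id_q_rho x : fubini tL e (range piL) x -> id_q (id_rho x) = x.
  apply: (ucp_fubini_id tL_tensor e_basis oL (ucp_comp id_rho_ucp id_q_ucp)).
  move=> a b _ [f _ <-] /=.
  (* On E_ab (x) piL f, [id_rho] gives E_ab (x) piM (rho f), and [id_q] turns this into E_ab (x) piL
     (q (rho f)), where q (rho f) = f. *)
  have bT (i : 'I_1) := rank_one_bounded_op (e a) (e b).
  have sumL := munit_is_sum_tensor e tL_tensor a b.
  have sumM := munit_is_sum_tensor e tM_tensor a b.
  rewrite (id_rho_ext _ _ (fun=> f) _ _ bT (sumL _ (bL f)) (sumM _ (bM (rho f)))).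
  apply: (id_q_ext _ _ (fun=> rho f) _ _ bT (sumM _ (bM (rho f)))).
  by rewrite rho_lifting.2; exact: sumL.
split=> //; split=> //.
  move=> x y /set_mem Lx /set_mem Ly xy.
  by rewrite -(id_q_rho x)// xy id_q_rho.
have [[id_rhoS _ _] _] := id_rho_ucp; have [[id_qS q_lin q_pos] _] := id_q_ucp.
have imS y : (id_rho @` fubini tL e (range piL)) y -> fubini tM e (range piM) y.
  by move=> [x Lx <-]; exact: id_rhoS.
(* Complete positivity of [id_q] passes to the range of [id_rho], as this lies in its domain. *)
exists id_q; split=> //; split.
- by move=> y /imS; exact: id_qS.
- by move=> a x y /imS Mx /imS My; exact: q_lin.
- by move=> n x xS; apply: q_pos => i j; exact/imS/xS.
Qed.
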